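(* Let $m>1$ and $\pi\in S_m$. For $n\ge m$, let $X_\pi$ be the random variable on $S_n$ (uniform distribution) with $X_\pi(\tau)$ the number of occurrences of $\pi$ in $\tau$. Then, as $n\to\infty$, $$V\!ar(X_\pi)=c(\pi) n^{2m-1}+O(n^{2m-2}),$$ where $$c(\pi)=\frac{1}{((2m-1)!)^2}\left(\mathrm{Tr}(A_mP_{\pi}A_mP_{\pi}^{-1})-\binom{2m-1}{m-1}^2\right)>0,$$ and $$\mathrm{Tr}(A_mP_{\pi}A_mP_{\pi}^{-1})=\sum_{i,j=1}^{m}[i,j]_m\,[\pi(i),\pi(j)]_m.$$ Consequently the standard deviation satisfies $\sigma(X_\pi)=\sqrt{c(\pi)}\, n^{m-\frac{1}{2}}+O(n^{m-1})$.
   Context: An occurrence of $\pi\in S_m$ in $\tau\in S_n$ is a set of $m$ positions of $\tau$ such that the subsequence of $\tau$ at those positions is order-isomorphic to $\pi$. $P_\pi=[\delta(\pi(i),j)]_{m\times m}$ is the permutation matrix of $\pi$ ($\delta$ the Kronecker delta). For integers $1\le i,j\le m$, $[i,j]_m=\binom{i-1+j-1}{i-1}\binom{m-i+m-j}{m-i}$, and $A_m$ is the $m\times m$ matrix with $(A_m)_{ij}=[i,j]_m$. *)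

(* Defs.v *)
From mathcomp Require Export all_boot all_order all_algebra perm.
From mathcomp Require Export boolp classical_sets functions filter reals topology normedtype landau exp.
Export Order.TTheory GRing.Theory Num.Theory numFieldNormedType.Exports.

Set Implicit Arguments.
Unset Strict Implicit.
Unset Printing Implicit Defensive.

Local Open Scope ring_scope.

(* The increasing enumeration f of D reads off the subsequence of tau at D. *)
Definition is_occurrence (m n : nat) (pi : 'S_m) (tau : 'S_n) (D : {set 'I_n}) : bool :=
  [exists f : {ffun 'I_m -> 'I_n},
    [&& [forall i : 'I_m, forall j : 'I_m, (i < j)%N ==> (f i < f j)%N],
        D == [set f i | i : 'I_m]
      & [forall i : 'I_m, forall j : 'I_m, (tau (f i) < tau (f j))%N == (pi i < pi j)%N]]].

Definition nocc (m n : nat) (pi : 'S_m) (tau : 'S_n) : nat :=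
  #|[set D : {set 'I_n} | is_occurrence pi tau D]|.

Section Uniform.
Variables (R : realType) (T : finType).
Implicit Type X : T -> R.

Definition unif_mean X : R := (\sum_(t : T) X t) / #|T|%:R.

Definition unif_var X : R := unif_mean (fun t => (X t - unif_mean X) ^+ 2).

Definition unif_sd X : R := Num.sqrt (unif_var X).

End Uniform.

Definition Xocc (R : realType) (m : nat) (pi : 'S_m) (n : nat) (tau : 'S_n) : R :=
  (nocc pi tau)%:R.

(* [i,j]_m, with the indices 1 <= i, j <= m; an element i : 'I_m stands for the
   index i.+1. *)
Definition bracket (m i j : nat) : nat :=
  ('C((i - 1) + (j - 1), i - 1) * 'C((m - i) + (m - j), m - i))%N.

Definition bracket_mx (R : realType) (m : nat) : 'M[R]_m :=
  \matrix_(i < m, j < m) (bracket m i.+1 j.+1)%:R.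

(* perm_mx pi has entries (pi i == j)%:R, i.e. it is the matrix P_pi. *)
Definition trace_term (R : realType) (m : nat) (pi : 'S_m) : R :=
  \tr (bracket_mx R m *m perm_mx pi *m bracket_mx R m *m invmx (perm_mx pi)).

Definition c_coef (R : realType) (m : nat) (pi : 'S_m) : R :=
  (((2 * m - 1)`!)%:R ^+ 2)^-1 *
  (trace_term R pi - ('C(2 * m - 1, m - 1))%:R ^+ 2).

(* Main.v *)
From mathcomp Require Import zify ring.
Require Import Defs.
From mathcomp Require Import fintype finset.

Set Implicit Arguments.
Unset Strict Implicit.
Unset Printing Implicit Defensive.

(** An occurrence of [pi] in [tau] is a pair of increasing maps [f], [h] (its
    positions and its values) such that [tau (f i) = h (pi i)].  Two occurrences
    [(f, h)], [(g, k)] of a common [tau] must have matching coincidences: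
    [f i = g j] iff [h (pi i) = k (pi j)]; conversely, if they match in exactly
    the set [M] of pairs [(i, j)], then [(n - (2m - #|M|))!] permutations
    contain both.  With [N(M)] the number of pairs [(f, g)] of increasing maps
    coinciding exactly on [M], this gives
      [\sum_tau nocc ^ 2 = \sum_M N(M) N(pi M) (n - 2m + #|M|)!].
    Divided by [n!], the term of [M] is [O(n ^ (2m - #|M|))], so only the empty
    set and the singletons matter, and [N({(i, j)}) = [i, j]_m 'C(n, 2m - 1)]
    produces the trace.

    For the positivity, the Vandermonde identity applied to both factors of
    [[i, j]_m] writes [A_m] as the Gram matrix of the vectors
    [v_(k, l)(i) = 'C(i - 1, k) 'C(m - i, l)].  As the rows of [A_m] all sum to
    ['C(2m - 1, m - 1)], centring these vectors turns the difference in [c(pi)]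
    into a sum of squares; it does not vanish because [v_(k, m - 1 - k)] is the
    [k + 1]-st unit vector. *)

Local Open Scope nat_scope.

(** * Increasing maps and extensions of partial permutations *)

Lemma card_ord_lt n k : k <= n -> #|[set j : 'I_n | j < k]| = k.
Proof.
move=> kn; have -> : [set j : 'I_n | j < k] = widen_ord kn @: 'I_k.
  apply/setP => j; rewrite inE; apply/idP/imsetP => [jk|[i _ ->]]; last by rewrite /= ltn_ord.
  by exists (Ordinal jk) => //; apply: val_inj.
rewrite card_imset ?card_ord // => i j eqij.
by apply: val_inj; exact: (congr1 val eqij).
Qed.

Lemma card_ord_gt n (c : 'I_n) : #|[set x : 'I_n | c < x]| = n.-1 - c.
Proof.
have -> : [set x : 'I_n | c < x] = ~: [set j : 'I_n | j < c.+1].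
  by apply/setP => x; rewrite !inE -leqNgt.
by rewrite cardsCs setCK card_ord card_ord_lt // subnS predn_sub.
Qed.

(** Both sides count the sets of [a + b + 1] points among [N], the left one by the element [c]
    having [a] smaller ones. *)
Lemma sum_binomial_mul N a b :
  \sum_(c < N) 'C(c, a) * 'C(N.-1 - c, b) = 'C(N, a + b.+1).
Proof.
elim: N a b => [|N IH] a b; first by rewrite big_ord0 addnS bin0n.
rewrite big_ord_recl /= subn0.
under eq_bigr => c _ do rewrite /bump leq0n add1n subnS predn_sub.
case: a => [|a].
  under eq_bigr => c _ do rewrite bin0 -(bin0 c).
  by rewrite IH bin0 mul1n !add0n binS addnC.
rewrite bin0n mul0n add0n.
under eq_bigr => c _ do rewrite binS mulnDl.
by rewrite big_split /= !IH addSn binS.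
Qed.

(** Worded as the monotonicity clause of [is_occurrence], so that it folds there by conversion. *)
Definition increasing (m n : nat) (f : {ffun 'I_m -> 'I_n}) : bool :=
  [forall i : 'I_m, forall j : 'I_m, (i < j) ==> (f i < f j)].

Lemma increasingP m n (f : {ffun 'I_m -> 'I_n}) :
  reflect {mono f : i j / i < j} (increasing f).
Proof.
apply: (iffP idP) => [/forallP H i j|H]; last first.
  by apply/forallP => i; apply/forallP => j; rewrite H implybb.
have Hf (a b : 'I_m) : a < b -> f a < f b.
  by move: (H a) => /forallP/(_ b)/implyP.
case: (ltngtP i j) => [/Hf //|/Hf ji|/val_inj ->]; last by rewrite ltnn.
by apply/negbTE; rewrite -leqNgt ltnW.
Qed.

Lemma increasing_inj m n (f : {ffun 'I_m -> 'I_n}) : increasing f -> injective f.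
Proof.
move=> /increasingP H i j eqf; apply: val_inj.
by case: (ltngtP i j) => // lt; move: (lt); rewrite -H eqf ltnn.
Qed.

(** The rank of [f i] in the image recovers [i], so an increasing map is determined by its image. *)
Lemma card_below_increasing m n (f : {ffun 'I_m -> 'I_n}) (i : 'I_m) :
  increasing f -> #|[set x in f @: 'I_m | x < f i]| = i.
Proof.
move=> incf; have -> : [set x in f @: 'I_m | x < f i] = f @: [set j : 'I_m | j < i].
  apply/setP => x; rewrite !inE; apply/andP/imsetP => [[/imsetP[j _ ->]]|[j]].
    by move/increasingP: incf => ->; exists j; rewrite ?inE.
  rewrite inE => ji ->; split; first exact: imset_f.
  by move/increasingP: incf => ->.
by rewrite (card_imset _ (increasing_inj incf)) card_ord_lt // ltnW.
Qed.

Lemma increasing_imset_inj m n (f g : {ffun 'I_m -> 'I_n}) :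
  increasing f -> increasing g -> f @: 'I_m = g @: 'I_m -> f = g.
Proof.
move=> incf incg eqfg; apply/ffunP => i.
have : f i \in g @: 'I_m by rewrite -eqfg imset_f.
case/imsetP => j _ fi; rewrite fi; congr (g _); apply: val_inj => /=.
by rewrite -(card_below_increasing j incg) -(card_below_increasing i incf) eqfg fi.
Qed.

Lemma increasing_of_set m n (D : {set 'I_n}) : #|D| = m ->
  exists2 f : {ffun 'I_m -> 'I_n}, increasing f & f @: 'I_m = D.
Proof.
move=> cD; pose f := [ffun i : 'I_m => enum_val (cast_ord (esym cD) i)].
have sorted_D : sorted ltn (map val (enum D)).
  rewrite -[enum _](eq_filter (mem_enum _)).
  rewrite -(eq_filter (mem_map val_inj _)) -filter_map.
  by rewrite (sorted_filter ltn_trans) // unlock val_ord_enum iota_ltn_sorted.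
exists f.
  apply/forallP => i; apply/forallP => j; apply/implyP => ij; rewrite !ffunE.
  have sizeD : size (enum D) = m by rewrite -cardE.
  set x0 := enum_val (cast_ord (esym cD) i).
  rewrite {1}/x0 !(enum_val_nth x0) /=.
  have := sorted_ltn_nth ltn_trans 0 sorted_D i j.
  by rewrite !inE size_map sizeD !ltn_ord !(nth_map x0) ?sizeD ?ltn_ord //; apply.
apply/eqP; rewrite eqEcard card_imset ?cD ?card_ord ?leqnn ?andbT; last first.
  by move=> i j; rewrite !ffunE => /enum_val_inj /cast_ord_inj.
by apply/subsetP => x /imsetP[i _ ->]; rewrite ffunE enum_valP.
Qed.

Lemma card_increasing m n : #|[set f : {ffun 'I_m -> 'I_n} | increasing f]| = 'C(n, m).
Proof.
rewrite -[X in 'C(X, _)]card_ord -card_draws.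
rewrite -(@card_in_imset _ _ (fun f : {ffun 'I_m -> 'I_n} => f @: 'I_m)).
  apply: eq_card => D; rewrite inE; apply/imsetP/eqP => [[f]|/increasing_of_set[f incf <-]].
    by rewrite inE => incf ->; rewrite card_imset ?card_ord//; apply: increasing_inj.
  by exists f; rewrite ?inE.
by move=> f g; rewrite !inE; apply: increasing_imset_inj.
Qed.

(** By the hypothesis, sending [u i] to [v i] is a well-defined partial injection. It extends to
    some permutation [s], and all extensions arise from [s] by first permuting the complement of the
    image of [u]. *)
Lemma card_perm_ext (T I : finType) (u v : I -> T) :
  (forall i j, (u i == u j) = (v i == v j)) ->
  #|[set s : {perm T} | [forall i, s (u i) == v i]]| = (#|T| - #|u @: I|)`!.
Proof.
move=> uv; have [s su] : exists s : {perm T}, forall i, s (u i) = v i.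
  suff [s su] : exists s : {perm T}, forall i, i \in enum I -> s (u i) = v i.
    by exists s => i; rewrite su ?mem_enum.
  elim: (enum I) => [|i l [s IH]]; first by exists 1%g.
  (* The transposition corrects the value at [u i]; by the hypothesis it leaves the values assigned
     earlier in place. *)
  exists (s * tperm (s (u i)) (v i))%g => j; rewrite inE permM.
  have [->|ji /= jl] := eqVneq j i; first by rewrite tpermL.
  have [uij|uij] := eqVneq (u i) (u j).
    by rewrite uij tpermL; apply/eqP; rewrite -uv uij.
  by rewrite tpermD ?(inj_eq perm_inj) ?(IH j jl) -?uv // eq_sym.
rewrite (_ : #|T| - _ = #|~: (u @: I)|); last by rewrite [RHS]cardsCs setCK.
rewrite -card_perm -[RHS](card_imset _ (mulIg s)); apply: eq_card => t.
rewrite inE; apply/forallP/imsetP => [H|[r rP -> i]].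
  exists (t * s^-1)%g; last by rewrite -mulgA mulVg mulg1.
  apply/subsetP => x; apply: contraR; rewrite !inE negbK => /imsetP[i _ ->].
  by rewrite permM (eqP (H i)) -su permK.
rewrite permM (out_perm rP) ?su // inE negbK; exact: imset_f.
Qed.

(** * The second moment *)

Section SecondMoment.
Variables (m n : nat).
Local Notation F := {ffun 'I_m -> 'I_n}.
Implicit Types (pi : 'S_m) (tau : 'S_n) (f g h k : F) (M : {set 'I_m * 'I_m}).

Definition transports pi tau f h := [forall i, tau (f i) == h (pi i)].

(** The set of positions determines [f], and then [h] must be [tau \o f \o pi^-1]; that this map
    increases is the order-isomorphism condition. *)
Lemma nocc_sum pi tau :
  nocc pi tau =
  \sum_(p : F * F | increasing p.1 && increasing p.2) transports pi tau p.1 p.2.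
Proof.
rewrite -big_mkcondr sum1dep_card /nocc.
rewrite -(@card_in_imset _ _ (fun p : F * F => p.1 @: 'I_m)); last first.
  move=> [f h] [g k]; rewrite !inE /= => /andP[/andP[incf _] /forallP fh].
  move=> /andP[/andP[incg _] /forallP gk] /(increasing_imset_inj incf incg) eqfg.
  rewrite {}eqfg {f incf} in fh *; congr (_, _); apply/ffunP => i.
  by rewrite -(permKV pi i) -(eqP (fh _)) -(eqP (gk _)).
apply: eq_card => D; rewrite !inE; apply/existsP/imsetP => [[f]|[[f h]]].
  rewrite -/(increasing f) => /and3P[incf /eqP -> /forallP taupi].
  exists (f, [ffun i => tau (f (pi^-1 i)%g)]) => //; rewrite inE /= incf /=.
  apply/andP; split; last by apply/forallP => i; rewrite ffunE permK.
  apply/increasingP => i j; rewrite !ffunE.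
  by have /forallP/(_ (pi^-1 j)%g)/eqP := taupi (pi^-1 i)%g; rewrite !permKV.
rewrite inE /= => /andP[/andP[incf /increasingP inch] /forallP fh] ->.
exists f; apply/and3P; split => //.
by apply/forallP => i; apply/forallP => j; rewrite !(eqP (fh _)) inch.
Qed.

(** Stated for plain functions in order to apply to [h \o pi] as well. *)
Definition coincidences (f g : 'I_m -> 'I_n) : {set 'I_m * 'I_m} :=
  [set x | f x.1 == g x.2].

(** The two families are merged so that two transport conditions become a single instance of
    [card_perm_ext]. *)
Definition pair_fun (f g : 'I_m -> 'I_n) (x : 'I_m + 'I_m) : 'I_n :=
  match x with inl i => f i | inr j => g j end.

(** Inclusion-exclusion: as both maps are injective, coincidences correspond to the points common to
    the two images. *)
Lemma card_pair_fun f g : increasing f -> increasing g ->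
  #|pair_fun f g @: {: 'I_m + 'I_m}| = 2 * m - #|coincidences f g|.
Proof.
move=> incf incg.
have -> : pair_fun f g @: {: 'I_m + 'I_m} = f @: 'I_m :|: g @: 'I_m.
  apply/setP => x; rewrite inE; apply/imsetP/orP => [[[i|i] _ ->]|[] /imsetP[i _ ->]].
  - by left; apply: imset_f.
  - by right; apply: imset_f.
  - by exists (inl i).
  - by exists (inr i).
have fI := increasing_inj incf; have gI := increasing_inj incg.
rewrite cardsU !card_imset // !card_ord mul2n -addnn; congr (_ - _).
rewrite -(@card_in_imset _ _ (fun x => f x.1) (mem (coincidences f g))); last first.
  move=> [i j] [i' j']; rewrite !inE /= => /eqP fg /eqP fg' ff'.
  by rewrite (fI _ _ ff') (gI j j') // -fg ff'.
apply: eq_card => x; rewrite inE; apply/andP/imsetP => [[/imsetP[i _ ->]]|].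
  by case/imsetP => j _ fg; exists (i, j) => //; rewrite inE /= fg.
move=> [[i j]]; rewrite inE /= => /eqP fg ->.
by split; [apply: imset_f | rewrite fg; apply: imset_f].
Qed.

Definition coincidence_number M : nat :=
  #|[set p : F * F | [&& increasing p.1, increasing p.2 & coincidences p.1 p.2 == M]]|.

Definition perm_pairs pi M : {set 'I_m * 'I_m} := [set (pi x.1, pi x.2) | x in M].

Lemma coincidences_perm pi h k M :
  (coincidences h k == perm_pairs pi M) = (coincidences (h \o pi) (k \o pi) == M).
Proof.
have pipi : injective (fun x : 'I_m * 'I_m => (pi x.1, pi x.2)).
  by move=> [a b] [c d] [/perm_inj -> /perm_inj ->].
have -> : coincidences h k = perm_pairs pi (coincidences (h \o pi) (k \o pi)).
  apply/setP => -[i j]; rewrite -(permKV pi i) -(permKV pi j).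
  have := mem_imset (coincidences (h \o pi) (k \o pi)) ((pi^-1 i)%g, (pi^-1 j)%g) pipi.
  by rewrite /= !inE => ->.
by rewrite (inj_eq (imset_inj pipi)).
Qed.

(** The two conditions prescribe [tau] on the joint family [u]. The prescription is consistent and
    injective exactly when the coincidences match; otherwise no [tau] satisfies it. *)
Lemma card_transports2 pi f g h k :
  increasing f -> increasing g -> increasing h -> increasing k ->
  #|[set tau | transports pi tau f h && transports pi tau g k]| =
  (coincidences h k == perm_pairs pi (coincidences f g)) *
    (n - (2 * m - #|coincidences f g|))`!.
Proof.
move=> incf incg inch inck; rewrite coincidences_perm.
pose u := pair_fun f g; pose v := pair_fun (h \o pi) (k \o pi).
have -> : [set tau | transports pi tau f h && transports pi tau g k] =
    [set tau : 'S_n | [forall x, tau (u x) == v x]].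
  apply/setP => tau; rewrite !inE.
  apply/andP/forallP => [[/forallP fh /forallP gk] [] //|uv].
  by split; apply/forallP => i; [exact: (uv (inl i))|exact: (uv (inr i))].
have [/setP eqc|neqc] := eqVneq (coincidences _ _) _.
  rewrite mul1n -card_pair_fun // card_perm_ext ?card_ord // => -[i|i] [j|j].
  - by rewrite /= !(inj_eq (increasing_inj _)) ?(inj_eq perm_inj).
  - by have := eqc (i, j); rewrite !inE /= => ->.
  - by have := eqc (j, i); rewrite !inE /= eq_sym => ->; rewrite eq_sym.
  - by rewrite /= !(inj_eq (increasing_inj _)) ?(inj_eq perm_inj).
rewrite mul0n; apply: eq_card0 => tau; rewrite inE.
apply: contraNF neqc => /forallP uv; apply/eqP/setP => -[i j]; rewrite !inE /=.
by have := uv (inl i); have := uv (inr j) => /eqP /= <- /eqP <-; rewrite (inj_eq perm_inj).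
Qed.

Lemma sum_nocc_sqr pi :
  \sum_(tau : 'S_n) nocc pi tau ^ 2 =
  \sum_M coincidence_number M * coincidence_number (perm_pairs pi M) *
    (n - (2 * m - #|M|))`!.
Proof.
pose inc2 (p : F * F) := increasing p.1 && increasing p.2.
(* [swap] regroups two occurrences [(f, h)], [(g, k)] into the position maps [(f, g)] and the value
   maps [(h, k)]. *)
pose swap (x : (F * F) * (F * F)) := ((x.1.1, x.2.1), (x.1.2, x.2.2)).
have swapK : involutive swap by move=> [[a b] [c d]].
transitivity (\sum_(p | inc2 p) \sum_(q | inc2 q)
    #|[set tau | transports pi tau p.1 q.1 && transports pi tau p.2 q.2]|).
  rewrite pair_big.
  under [RHS]eq_bigr => x _ do rewrite -sum1dep_card big_mkcond.
  rewrite exchange_big; apply: eq_bigr => tau _.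
  rewrite nocc_sum -mulnn big_distrlr pair_big (reindex_inj (inv_inj swapK)).
  apply: eq_big => [x|x _]; first by rewrite /= /inc2 andbACA.
  by rewrite /= mulnb; case: (_ && _).
transitivity (\sum_(p | inc2 p) \sum_(q | inc2 q)
    (coincidences q.1 q.2 == perm_pairs pi (coincidences p.1 p.2)) *
    (n - (2 * m - #|coincidences p.1 p.2|))`!).
  apply: eq_bigr => p /andP[? ?]; apply: eq_bigr => q /andP[? ?].
  exact: card_transports2.
rewrite (partition_big (fun p : F * F => coincidences p.1 p.2) predT) //=.
apply: eq_bigr => M _; rewrite -mulnA {1}/coincidence_number -sum1dep_card big_distrl /=.
apply: eq_big => [p|p /andP[_ /eqP ->]]; first by rewrite andbA.
rewrite mul1n -big_distrl /=; congr (_ * _).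
rewrite -big_mkcondr sum1dep_card; apply: eq_card => q.
by rewrite !inE andbA.
Qed.

Lemma sum_nocc pi : \sum_(tau : 'S_n) nocc pi tau = 'C(n, m) ^ 2 * (n - m)`!.
Proof.
under eq_bigr => tau _ do rewrite nocc_sum.
rewrite exchange_big -mulnn -!card_increasing -cardsX -sum_nat_const.
apply: eq_big => [p|p /andP[incf inch]]; first by rewrite !inE.
rewrite -big_mkcond sum1dep_card.
rewrite -[m in RHS]card_ord -(card_imset _ (increasing_inj incf)).
rewrite (@card_perm_ext _ _ p.1 (p.2 \o pi)) ?card_ord // => i j /=.
by rewrite !(inj_eq (increasing_inj _)) ?(inj_eq perm_inj).
Qed.

End SecondMoment.

(** * Coincidence numbers *)

(** Both sides count pairs of disjoint subsets of sizes [a] and [b] among [c] points; on the right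
    their union is chosen first. *)
Lemma bin_mul_disjoint c a b : 'C(c, a) * 'C(c - a, b) = 'C(a + b, a) * 'C(c, a + b).
Proof.
have [ltc|lec] := ltnP c (a + b).
  rewrite (bin_small ltc) muln0; have [/bin_small -> //|ac] := ltnP c a.
  by rewrite ['C(c - a, b)]bin_small ?muln0 // ltn_subLR.
have ac : a <= c by apply: leq_trans lec; apply: leq_addr.
have E1 := bin_fact ac; have E2 := bin_fact lec.
have bc : b <= c - a by rewrite leq_subRL.
have E3 := bin_fact bc; have E4 := bin_fact (leq_addr b a).
rewrite addKn in E4; rewrite subnDA in E2.
apply/eqP; rewrite -(eqn_pmul2r (fact_gt0 a)) -(eqn_pmul2r (fact_gt0 b)).
rewrite -(eqn_pmul2r (fact_gt0 (c - a - b))); apply/eqP.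
transitivity c`!; first by rewrite -E1 -E3; ring.
by rewrite -E2 -E4; ring.
Qed.

(** Such a [D] consists of [c], an arbitrary [a]-subset of [A] below it and an arbitrary [b]-subset
    of [B] above it. *)
Lemma card_split_sets n (c : 'I_n) (A B : {set 'I_n}) a b :
  A \subset [set x : 'I_n | x < c] -> B \subset [set x : 'I_n | c < x] ->
  #|[set D : {set 'I_n} | [&& c \in D, D \subset c |: (A :|: B),
       #|[set x in D | x < c]| == a & #|[set x : 'I_n in D | c < x]| == b]]| =
  'C(#|A|, a) * 'C(#|B|, b).
Proof.
move=> /fintype.subsetP Ac /fintype.subsetP Bc; rewrite -!cards_draws -cardsX.
pose join (XY : {set 'I_n} * {set 'I_n}) := c |: (XY.1 :|: XY.2).
have joinl (X Y : {set 'I_n}) : X \subset A -> Y \subset B -> [set x in join (X, Y) | x < c] = X.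
  move=> /fintype.subsetP XA /fintype.subsetP YB; apply/setP => x; rewrite !inE /=.
  apply/andP/idP => [[/or3P[/eqP ->|//|xY] xc]|xX].
  - by rewrite ltnn in xc.
  - by have := Bc _ (YB _ xY); rewrite inE ltnNge (ltnW xc).
  - by rewrite xX orbT; have := Ac _ (XA _ xX); rewrite inE.
have joinr (X Y : {set 'I_n}) : X \subset A -> Y \subset B ->
    [set x : 'I_n in join (X, Y) | c < x] = Y.
  move=> /fintype.subsetP XA /fintype.subsetP YB; apply/setP => x; rewrite !inE /=.
  apply/andP/idP => [[/or3P[/eqP ->|xX|//] xc]|xY].
  - by rewrite ltnn in xc.
  - by have := Ac _ (XA _ xX); rewrite inE ltnNge (ltnW xc).
  - by rewrite xY !orbT; have := Bc _ (YB _ xY); rewrite inE.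
rewrite -(@card_in_imset _ _ join); last first.
  move=> [X Y] [X' Y']; rewrite !inE /= => /andP[/andP[XA _] /andP[YB _]].
  move=> /andP[/andP[XA' _] /andP[YB' _]] eqj.
  have := joinl X Y XA YB; have := joinr X Y XA YB.
  by rewrite eqj joinl // joinr // => -> ->.
apply: eq_card => D; rewrite inE; apply/and4P/imsetP => [[cD DAB /eqP Da /eqP Db]|].
  exists ([set x in D | x < c], [set x : 'I_n in D | c < x]).
    rewrite !inE Da Db !eqxx !andbT /=; apply/andP; split; apply/fintype.subsetP => x.
      rewrite inE => /andP[/(fintype.subsetP DAB)]; rewrite !inE => /or3P[/eqP->|//|/Bc].
        by rewrite ltnn.
      by rewrite inE => /ltnW; rewrite ltnNge => ->.
    rewrite inE => /andP[/(fintype.subsetP DAB)]; rewrite !inE => /or3P[/eqP->|/Ac|//].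
      by rewrite ltnn.
    by rewrite inE => /ltnW; rewrite ltnNge => ->.
  apply/setP => x; rewrite !inE -andb_orr.
  by have [->|xc] := eqVneq x c; rewrite ?cD //= -neq_ltn (inj_eq val_inj) xc andbT.
move=> [[X Y]]; rewrite !inE /= => /andP[/andP[XA /eqP Xa] /andP[YB /eqP Yb]] ->.
rewrite joinl // joinr // Xa Yb; split => //; first by rewrite setU11.
by rewrite setUS // setUSS.
Qed.

Section CoincidenceNumber.
Variables (m n : nat).
Local Notation F := {ffun 'I_m -> 'I_n}.
Implicit Types (f g : F) (M : {set 'I_m * 'I_m}) (c : 'I_n).

Lemma card_increasing_pairs (P : pred ({set 'I_n} * {set 'I_n})) :
  #|[set p : F * F | [&& increasing p.1, increasing p.2 & P (p.1 @: 'I_m, p.2 @: 'I_m)]]| =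
  #|[set D : {set 'I_n} * {set 'I_n} | [&& #|D.1| == m, #|D.2| == m & P D]]|.
Proof.
pose img (p : F * F) := (p.1 @: 'I_m, p.2 @: 'I_m).
rewrite -(@card_in_imset _ _ img); last first.
  move=> [f g] [f' g']; rewrite !inE /= => /and3P[? ? _] /and3P[? ? _] [eqf eqg].
  by congr (_, _); apply: increasing_imset_inj.
apply: eq_card => -[D E]; rewrite inE /=; apply/imsetP/and3P => [[[f g]]|].
  rewrite inE /= => /and3P[incf incg PDE] [-> ->]; split => //.
    by rewrite card_imset ?card_ord//; apply: increasing_inj.
  by rewrite card_imset ?card_ord//; apply: increasing_inj.
move=> [/eqP/increasing_of_set[f incf fD] /eqP/increasing_of_set[g incg gE]] PDE.
by exists (f, g); rewrite ?inE /img /= ?incf ?incg fD gE.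
Qed.

(** No coincidence means disjoint images: the second [m]-set is chosen in the complement of the
    first. *)
Lemma coincidence_number0 :
  coincidence_number n (set0 : {set 'I_m * 'I_m}) = 'C(n, m) * 'C(n - m, m).
Proof.
transitivity #|[set D : {set 'I_n} * {set 'I_n} |
    [&& #|D.1| == m, #|D.2| == m & D.2 \subset ~: D.1]]|.
  rewrite -card_increasing_pairs; apply: eq_card => -[f g]; rewrite !inE /=.
  congr [&& _, _ & _]; apply/eqP/fintype.subsetP => [/setP c0 x|fg].
    case/imsetP => j _ ->; rewrite inE; apply/imsetP => -[i _ fg].
    by have := c0 (i, j); rewrite !inE /= fg eqxx.
  apply/setP => -[i j]; rewrite !inE /=; apply/eqP => fg'.
  have : g j \in ~: f @: 'I_m by apply: fg; apply: imset_f.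
  by rewrite inE -fg' imset_f.
rewrite -sum1dep_card (eq_bigl (fun D : {set 'I_n} * {set 'I_n} =>
  (#|D.1| == m) && ((#|D.2| == m) && (D.2 \subset ~: D.1)))) //.
rewrite -(pair_big_dep (fun D : {set 'I_n} => #|D| == m)
  (fun D E : {set 'I_n} => (#|E| == m) && (E \subset ~: D)) (fun _ _ => 1)) /=.
under eq_bigr => D /eqP Dm.
  rewrite sum1dep_card (_ : [set _ | _] = [set E : {set 'I_n} | E \subset ~: D & #|E| == m]).
    by rewrite cards_draws cardsCs setCK card_ord Dm over.
  by apply/setP => E; rewrite !inE andbC.
by rewrite sum_nat_const -[X in 'C(X, _) * _]card_ord -card_draws cardsE.
Qed.

(** [D.1] takes [i] points below [c] and [m - 1 - i] above. [D.2] then draws its points other than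
    [c] from those left free on each side. *)
Lemma card_pairs_meeting_at c (i j : 'I_m) :
  #|[set D : {set 'I_n} * {set 'I_n} | [&& #|D.1| == m, #|D.2| == m &
      [&& D.1 :&: D.2 == [set c], #|[set x in D.1 | x < c]| == i
        & #|[set x in D.2 | x < c]| == j]]]| =
  'C(c, i) * 'C(n.-1 - c, m.-1 - i) * ('C(c - i, j) * 'C(n.-1 - c - (m.-1 - i), m.-1 - j)).
Proof.
have [im jm] := (ltn_ord i, ltn_ord j).
pose L := [set x : 'I_n | x < c]; pose R := [set x : 'I_n | c < x].
pose split (A B : {set 'I_n}) (k l : nat) (D : {set 'I_n}) :=
  [&& c \in D, D \subset c |: (A :|: B),
    #|[set x in D | x < c]| == k & #|[set x : 'I_n in D | c < x]| == l].
have cardD (D : {set 'I_n}) : c \in D ->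
    #|D| = (#|[set x in D | x < c]| + #|[set x : 'I_n in D | c < x]|).+1.
  move=> cD; rewrite (cardsD1 c D) cD add1n -cardsUI [X in _ + X]eq_card0 ?addn0.
    congr _.+1; apply: eq_card => x; rewrite !inE -andb_orr andbC.
    by rewrite -(inj_eq val_inj) neq_ltn.
  by move=> x; rewrite !inE; case: ltngtP; rewrite ?andbF.
have LRT (D : {set 'I_n}) : D \subset c |: (L :|: R).
  apply/fintype.subsetP => x _; rewrite !inE -(inj_eq val_inj) /=.
  by case: ltngtP.
(* The number of points above [c] is forced by the total [m]. *)
have eqsplit (D : {set 'I_n}) (k : 'I_m) : c \in D ->
    (#|D| == m) && (#|[set x in D | x < c]| == k) = split L R k (m.-1 - k) D.
  move=> cD; rewrite /split cD LRT /= cardD // andbC; have km := ltn_ord k.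
  by have [->|//] /= := eqVneq #|[set x in D | x < c]| k; apply/eqP/eqP; lia.
transitivity (\sum_(D | split L R i (m.-1 - i) D)
    #|[set E | split (L :\: D) (R :\: D) j (m.-1 - j) E]|).
  under [RHS]eq_bigr => D _ do rewrite -sum1dep_card.
  rewrite -sum1dep_card pair_big_dep; apply: eq_bigl => -[D E] /=.
  have [cD|cD] := boolP (c \in D); last first.
    rewrite {1}/split (negbTE cD) /=; apply/negP => /and3P[_ _ /and3P[/eqP/setP/(_ c)]].
    by rewrite !inE eqxx (negbTE cD).
  have [cE|cE] := boolP (c \in E); last first.
    rewrite {2}/split (negbTE cE) andbF; apply/negP => /and3P[_ _ /and3P[/eqP/setP/(_ c)]].
    by rewrite !inE eqxx (negbTE cE) andbF.
  rewrite -eqsplit //.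
  have -> : split (L :\: D) (R :\: D) j (m.-1 - j) E =
      (D :&: E == [set c]) && split L R j (m.-1 - j) E.
    rewrite /split cE LRT /=; congr (_ && _); apply/fintype.subsetP/eqP => [sub|/setP DE x xE].
        apply/setP => x; rewrite !inE; apply/andP/eqP => [[xD xE]|-> //].
        by have := sub x xE; rewrite !inE xD /= orbF => /eqP.
      have := DE x; have /fintype.subsetP/(_ x xE) := LRT E; rewrite !inE xE andbT.
      by case: (x == c) => //= lt ->.
  rewrite -eqsplit //; move: (D :&: E == _) => b.
  by case: (#|D| == m); case: (#|E| == m); case: b; rewrite /= ?andbF ?andbT.
have cL : #|L| = c by rewrite card_ord_lt // ltnW.
have cR : #|R| = n.-1 - c by rewrite card_ord_gt.
under eq_bigr => D /and4P[cD _ /eqP Di /eqP Dj].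
  rewrite card_split_sets ?subsetDl // !cardsD cL cR.
  rewrite (_ : L :&: D = [set x in D | x < c]); last by apply/setP => x; rewrite !inE andbC.
  rewrite (_ : R :&: D = [set x : 'I_n in D | c < x]); last by apply/setP => x; rewrite !inE andbC.
  rewrite Di Dj; over.
rewrite sum_nat_const; congr (_ * _).
have := card_split_sets i (m.-1 - i) (fintype.subxx L) (fintype.subxx R).
by rewrite cL cR => <-; apply: eq_card => D; rewrite inE.
Qed.

(** The common value [c] has rank [i] in one image and [j] in the other. For each [c],
    [bin_mul_disjoint] extracts the two factors of the bracket, and [sum_binomial_mul] sums what
    remains over [c]. *)
Lemma coincidence_number1 (i j : 'I_m) :
  coincidence_number n [set (i, j)] = bracket m i.+1 j.+1 * 'C(n, 2 * m - 1).
Proof.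
have [im jm] := (ltn_ord i, ltn_ord j).
transitivity (\sum_(c < n) 'C(c, i) * 'C(n.-1 - c, m.-1 - i) *
   ('C(c - i, j) * 'C(n.-1 - c - (m.-1 - i), m.-1 - j))); last first.
  (* Of the [2m - 1] values, [i + j] lie below [c] and the others, apart from [c] itself, above
     it. *)
  have -> : 2 * m - 1 = (i + j) + ((m.-1 - i) + (m.-1 - j)).+1 by lia.
  rewrite -sum_binomial_mul big_distrr /=; apply: eq_bigr => c _.
  rewrite mulnACA !bin_mul_disjoint mulnACA /bracket !subn1 /=.
  by rewrite !subnS -!predn_sub.
rewrite /coincidence_number -sum1dep_card (partition_big (fun p : F * F => p.1 i) predT) //=.
apply: eq_bigr => c _; rewrite -card_pairs_meeting_at -card_increasing_pairs sum1dep_card.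
apply: eq_card => -[f g]; rewrite !inE /=.
have [incf|] := boolP (increasing f) => //=.
have [incg|] := boolP (increasing g) => //=.
have [fI gI] := (increasing_inj incf, increasing_inj incg).
apply/andP/and3P => [[/eqP/setP cM /eqP fc]|[/eqP/setP fg /eqP fi /eqP gj]].
  have gc : g j = c by have := cM (i, j); rewrite !inE /= eqxx fc => /eqP.
  rewrite -{2}fc -gc !card_below_increasing //; split=> //.
  apply/eqP/setP => x; rewrite !inE; apply/andP/eqP => [[/imsetP[i' _ ->] /imsetP[j' _ fg]]|->].
    by have := cM (i', j'); rewrite !inE /= fg eqxx => /esym/eqP[_ ->].
  by split; [rewrite gc -fc | ]; apply: imset_f.
have := fg c; rewrite !inE eqxx => /andP[/imsetP[i' _ ci'] /imsetP[j' _ cj']].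
have {ci' i' fi} fic : f i = c.
  by rewrite ci'; congr (f _); apply/val_inj; rewrite /= -fi ci' card_below_increasing.
have {cj' j' gj} gjc : g j = c.
  by rewrite cj'; congr (g _); apply/val_inj; rewrite /= -gj cj' card_below_increasing.
rewrite fic eqxx; split=> //; apply/eqP/setP => -[i' j']; rewrite !inE /=.
apply/eqP/eqP => [fg'|[-> ->]]; last by rewrite fic gjc.
have := fg (f i'); rewrite !inE imset_f // {1}fg' imset_f //= => /esym/eqP fc'.
by congr (_, _); [apply: fI; rewrite fc'|apply: gI; rewrite -fg' fc'].
Qed.

(** There are at most [n ^ m] choices of [f]; then [g] is prescribed at the [#|M|] indices occurring
    as second coordinates in [M]. *)
Lemma coincidence_number_le M : coincidence_number n M <= n ^ (2 * m - #|M|).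
Proof.
have [->|] := posnP (coincidence_number n M) => //.
rewrite card_gt0 => /set0Pn[[f0 g0]]; rewrite inE /= => /and3P[incf0 incg0 /eqP M0].
(* A pair realising [M] shows that distinct elements of [M] have distinct second coordinates; hence
   the separate treatment of a zero count. *)
have sndI : {in M &, injective snd}.
  move=> [i j] [i' j']; rewrite -M0 !inE /= => /eqP fg /eqP fg' eqj.
  by rewrite eqj; congr (_, _); apply: (increasing_inj incf0); rewrite fg fg' eqj.
(* The values left to [g j] once [f] is known: at most one if [j] is a second coordinate in [M]. *)
pose fam f (j : 'I_m) := [pred x : 'I_n | [forall i, ((i, j) \in M) ==> (f i == x)]].
have cM : #|snd @: M| = #|M| by rewrite card_in_imset.
have Mm : #|M| <= m by rewrite -cM -[X in _ <= X]card_ord max_card.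
have -> : 2 * m - #|M| = m + (m - #|M|) by lia.
apply: (@leq_trans (\sum_(f : F) #|family (fam f)|)).
  under [X in _ <= X]eq_bigr => f _ do rewrite -sum1_card.
  rewrite pair_big_dep /coincidence_number -sum1dep_card big_mkcond [X in _ <= X]big_mkcond.
  apply: leq_sum => -[f g] _ /=; case: and3P => // -[_ _ /eqP cM'].
  rewrite (_ : _ \in _) //; apply/familyP => j; rewrite inE.
  by apply/forallP => i; rewrite -cM' inE; apply/implyP.
rewrite expnD; have -> : n ^ m = #|F| by rewrite card_ffun !card_ord.
rewrite -sum_nat_const; apply: leq_sum => f _; rewrite card_family.
have -> : m - #|M| = #|~: (snd @: M)| by rewrite [RHS]cardsCs setCK card_ord cM.
rewrite -prod_nat_const [X in _ <= X]big_mkcond foldrE big_map big_enum /=.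
apply: leq_prod => j _; rewrite inE; case: ifP => [_|/negbFE/imsetP[[i j'] ijM /= ->]].
  by rewrite -[X in _ <= X]card_ord max_card.
rewrite -(card1 (f i)); apply: subset_leq_card; apply/fintype.subsetP => x.
by rewrite !inE => /forallP/(_ i); rewrite ijM eq_sym.
Qed.

End CoincidenceNumber.

Local Open Scope ring_scope.

(** * Trace and positivity *)

Lemma bracketC m i j : bracket m i j = bracket m j i.
Proof.
rewrite /bracket [((j - 1) + _)%N]addnC [((m - j) + _)%N]addnC; congr muln.
  by rewrite -bin_sub ?leq_addr // addKn.
by rewrite -bin_sub ?leq_addr // addKn.
Qed.

(** Conjugation by [perm_mx pi] permutes the rows and columns of the second bracket matrix by [pi];
    the symmetry of the bracket then aligns the indices. *)
Lemma trace_termE (R : realType) m (pi : 'S_m) :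
  trace_term R pi = \sum_(i < m) \sum_(j < m)
    (bracket m i.+1 j.+1)%:R * (bracket m (pi i).+1 (pi j).+1)%:R.
Proof.
have permV : invmx (perm_mx pi) = perm_mx (pi^-1)%g :> 'M[R]_m.
  rewrite -[RHS](mulKmx (unitmx_perm R pi)) -perm_mxM mulgV perm_mx1.
  by rewrite mulmx1.
rewrite /trace_term permV -!mulmxA -col_permE -row_permE /mxtrace.
apply: eq_bigr => i _; rewrite mxE; apply: eq_bigr => j _.
by rewrite !mxE [X in _ * X%:R]bracketC.
Qed.

Section Nat.
Local Open Scope nat_scope.

(** Vandermonde's identity after ['C(a, k) = 'C(a, a - k)]; the terms with [k > a] vanish. *)
Lemma sum_bin_mul_bin a b N : a < N -> \sum_(k < N) 'C(a, k) * 'C(b, k) = 'C(a + b, a).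
Proof.
move=> aN; rewrite addnC -binomial.Vandermonde.
rewrite (big_ord_widen N (fun j => 'C(b, j) * 'C(a, a - j))) //.
rewrite [RHS]big_mkcond /=; apply: eq_bigr => k _; rewrite ltnS.
by case: leqP => [ka|ak]; [rewrite bin_sub // mulnC | rewrite bin_small].
Qed.

Lemma bracket_sum_mul m (i j : 'I_m) :
  bracket m i.+1 j.+1 = \sum_(x : 'I_m * 'I_m)
    ('C(i, x.1) * 'C(m.-1 - i, x.2)) * ('C(j, x.1) * 'C(m.-1 - j, x.2)).
Proof.
have [im jm] := (ltn_ord i, ltn_ord j).
rewrite /bracket !subn1 /= !subnS !predn_sub.
rewrite -(sum_bin_mul_bin j im) -(@sum_bin_mul_bin _ (m.-1 - j) m); last by lia.
rewrite big_distrlr pair_big; apply: eq_bigr => x _ /=; exact: mulnACA.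
Qed.

(** With [c = i + j] the sum becomes that of [sum_binomial_mul] for [N = 2m - 1], whose terms vanish
    unless [i <= c < i + m]. *)
Lemma sum_bracket m (i : 'I_m) : \sum_(j < m) bracket m i.+1 j.+1 = 'C(2 * m - 1, m - 1).
Proof.
have im := ltn_ord i.
have -> : 'C(2 * m - 1, m - 1) = 'C(2 * m - 1, i + (m.-1 - i).+1).
  by rewrite -bin_sub; [congr 'C(_, _)|]; lia.
rewrite -sum_binomial_mul -(big_mkord xpredT (fun j => bracket m i.+1 j.+1)).
pose G c := 'C(c, i) * 'C((2 * m - 1).-1 - c, m.-1 - i).
rewrite -(big_mkord xpredT G).
have le1 : i <= 2 * m - 1 by lia.
have le2 : i + m <= 2 * m - 1 by lia.
rewrite [RHS](big_cat_nat (n := i)) // [X in _ = _ + X](big_cat_nat (leq_addr m i) le2) /=.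
have -> : \sum_(0 <= c < i) G c = 0.
  by rewrite big_nat_cond big1 // => c /andP[/andP[_ ci] _]; rewrite /G bin_small.
have -> : \sum_(i + m <= c < 2 * m - 1) G c = 0.
  rewrite big_nat_cond big1 // => c /andP[/andP[ci cm] _].
  by rewrite /G ['C((2 * m - 1).-1 - c, _)]bin_small ?muln0 //; lia.
rewrite add0n addn0.
have := big_addn 0 (i + m) i xpredT G; rewrite add0n addKn => ->.
rewrite big_nat_cond [RHS]big_nat_cond.
apply: eq_bigr => j /andP[/andP[_ jm] _].
rewrite /G /bracket !subn1 /= [(j + i)%N]addnC; congr (_ * 'C(_, _)); lia.
Qed.

End Nat.

(* Removing the mean of the vectors [v x] subtracts the constant [s / m] from
   every entry of their Gram matrix [A]. *)
Lemma sum_gram_perm (R : fieldType) (X : finType) m (v : X -> 'I_m -> R) s (pi : 'S_m) :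
  m%:R != 0 :> R ->
  (forall i, \sum_(j < m) \sum_x v x i * v x j = s) ->
  let w x i := v x i - (\sum_(j < m) v x j) / m%:R in
  \sum_(i < m) \sum_(j < m)
    (\sum_x v x i * v x j) * (\sum_x v x (pi i) * v x (pi j)) =
  s ^+ 2 + \sum_x \sum_y (\sum_(i < m) w x i * w y (pi i)) ^+ 2.
Proof.
move=> m0 rowsum w; pose mu x := (\sum_(j < m) v x j) / m%:R.
pose A i j := \sum_x v x i * v x j.
have vmu i : \sum_x v x i * mu x = s / m%:R.
  under eq_bigr => x _ do rewrite mulrA big_distrr.
  by rewrite -big_distrl exchange_big rowsum.
have mumu : \sum_x mu x * mu x = s / m%:R.
  transitivity ((\sum_(i < m) \sum_x v x i * mu x) / m%:R).
    rewrite exchange_big big_distrl; apply: eq_bigr => x _ /=.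
    by rewrite -big_distrl /= {1}/mu mulrAC.
  under eq_bigr => i _ do rewrite vmu.
  by rewrite sumr_const card_ord -[X in X / _]mulr_natl mulrC mulKf.
have wA i j : \sum_x w x i * w x j = A i j - s / m%:R.
  rewrite -[X in _ - X](_ : s / m%:R + s / m%:R - s / m%:R = _); last by rewrite addrK.
  rewrite -{1}(vmu i) -{1}(vmu j) -mumu /A -big_split -sumrB -sumrB.
  by apply: eq_bigr => x _; rewrite /w -/(mu x) /=; ring.
have sumA : \sum_(i < m) \sum_(j < m) A i j = m%:R * s.
  by under eq_bigr => i _ do rewrite rowsum; rewrite sumr_const card_ord mulr_natl.
have sumApi : \sum_(i < m) \sum_(j < m) A (pi i) (pi j) = m%:R * s.
  rewrite -sumA [RHS](reindex_inj (@perm_inj _ pi)); apply: eq_bigr => i _.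
  by rewrite [RHS](reindex_inj (@perm_inj _ pi)).
(* Expanding the squares and summing over [x] and [y] first leaves products of entries of two
   centred Gram matrices. *)
have -> : \sum_x \sum_y (\sum_(i < m) w x i * w y (pi i)) ^+ 2 =
    \sum_(i < m) \sum_(j < m) (A i j - s / m%:R) * (A (pi i) (pi j) - s / m%:R).
  transitivity (\sum_(x : X) \sum_(y : X) \sum_(i < m) \sum_(j < m)
      (w x i * w x j) * (w y (pi i) * w y (pi j))).
    apply: eq_bigr => x _; apply: eq_bigr => y _; rewrite expr2 big_distrlr.
    by apply: eq_bigr => i _; apply: eq_bigr => j _; rewrite mulrACA.
  under eq_bigr => x _ do rewrite exchange_big.
  rewrite exchange_big; apply: eq_bigr => i _ /=.
  under eq_bigr => x _ do rewrite exchange_big.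
  rewrite exchange_big; apply: eq_bigr => j _ /=.
  by rewrite -!wA big_distrlr.
transitivity (\sum_(i < m) \sum_(j < m) (A i j * A (pi i) (pi j))) => //.
(* As both entry sums equal [m * s], the correction terms add up to [- 2 s^2 + s^2 = - s^2]. *)
have -> : \sum_(i < m) \sum_(j < m) (A i j - s / m%:R) * (A (pi i) (pi j) - s / m%:R) =
    \sum_(i < m) \sum_(j < m) (A i j * A (pi i) (pi j)) -
    s / m%:R * (\sum_(i < m) \sum_(j < m) A i j) -
    s / m%:R * (\sum_(i < m) \sum_(j < m) A (pi i) (pi j)) +
    \sum_(i < m) \sum_(j < m) (s / m%:R) ^+ 2.
  rewrite !big_distrr -!sumrB -big_split; apply: eq_bigr => i _.
  rewrite !big_distrr -!sumrB -big_split; apply: eq_bigr => j _ /=; ring.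
rewrite sumA sumApi !sumr_const card_ord -mulrnA -[_ *+ (m * m)]mulr_natl natrM.
move: (\sum_(i < m) _) => T; field.
exact: m0.
Qed.

Lemma bin_mul_delta m (k i : 'I_m) : ('C(i, k) * 'C(m.-1 - i, m.-1 - k))%N = (i == k).
Proof.
have [im km] := (ltn_ord i, ltn_ord k).
have [->|ik] := eqVneq i k; first by rewrite !binn.
case: (ltngtP i k) => [lt|lt|/val_inj eq]; last by rewrite eq eqxx in ik.
  by rewrite bin_small.
by rewrite ['C(m.-1 - i, _)]bin_small ?muln0 //; lia.
Qed.

Lemma c_coef_gt0 (R : realType) m (pi : 'S_m) : (1 < m)%N -> 0 < c_coef R pi.
Proof.
move=> m1; have m0 : (m%:R : R) != 0 by rewrite pnatr_eq0; lia.
rewrite /c_coef mulr_gt0 ?invr_gt0 ?exprn_gt0 ?ltr0n ?fact_gt0 // trace_termE.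
pose v (x : 'I_m * 'I_m) (i : 'I_m) : R := ('C(i, x.1) * 'C(m.-1 - i, x.2))%N%:R.
have vA (i j : 'I_m) : (bracket m i.+1 j.+1)%:R = \sum_x v x i * v x j.
  rewrite bracket_sum_mul natr_sum; apply: eq_bigr => x _; exact: natrM.
under eq_bigr => i _ do under eq_bigr => j _ do rewrite !vA.
have rowsum (i : 'I_m) : \sum_(j < m) \sum_x v x i * v x j = 'C(2 * m - 1, m - 1)%:R.
  rewrite -(sum_bracket i) natr_sum; apply: eq_bigr => j _; exact/esym/vA.
pose w x i := v x i - (\sum_(j < m) v x j) / m%:R.
have -> : \sum_(i < m) \sum_(j < m)
    (\sum_x v x i * v x j) * (\sum_x v x (pi i) * v x (pi j)) =
    'C(2 * m - 1, m - 1)%:R ^+ 2 + \sum_x \sum_y (\sum_(i < m) w x i * w y (pi i)) ^+ 2.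
  exact: sum_gram_perm.
rewrite addrAC subrr add0r.
pose k := Ordinal (ltnW m1).
(* As [rev_ord a] is [m - 1 - a], the vector [v (e a)] is the unit vector at [a]. *)
pose e (a : 'I_m) := (a, rev_ord a).
have we (a i : 'I_m) : w (e a) i = (i == a)%:R - m%:R^-1.
  have ve j : v (e a) j = (j == a)%:R.
    by rewrite /v /e /= subnS predn_sub bin_mul_delta.
  rewrite /w ve; congr (_ - _); rewrite (bigD1 a) //= ve eqxx big1 ?addr0 ?mul1r //.
  by move=> j /negbTE ja; rewrite ve ja.
(* Only the square at [(e k, e (pi k))] is kept: its base is the sum of all [((i == k) - 1/m)^2],
   where [i = k] contributes [(1 - 1/m)^2 > 0]. *)
rewrite (bigD1 (e k)) //= (bigD1 (e (pi k))) //=.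
rewrite -addrA ltr_wpDr //.
  rewrite addr_ge0 ?sumr_ge0 // => *; first exact: sqr_ge0.
  by rewrite sumr_ge0 // => *; apply: sqr_ge0.
rewrite exprn_gt0 // (bigD1 k) //= !we !eqxx ltr_wpDr //.
  rewrite sumr_ge0 // => i _; rewrite !we (inj_eq perm_inj).
  by rewrite -expr2 sqr_ge0.
have : m%:R^-1 < 1 :> R by rewrite invf_lt1 ?ltr1n // ltr0n; lia.
by move=> h; rewrite mulr_gt0 // subr_gt0.
Qed.

(** * Asymptotics *)

Section PolyBounded.
Variable R : realType.
Implicit Types (u v : nat -> R) (d e k n : nat).

(** An elementary big-O whose degrees add up under products; it is turned into Landau notation only
    at the end. *)
Definition poly_bounded d u :=
  exists C N, forall n, (N <= n)%N -> `|u n| <= C * n%:R ^+ d.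

(** Comparing powers of [n] calls for [0 <= C] and [1 <= n]. *)
Lemma poly_bounded_pos d u : poly_bounded d u ->
  exists C N, [/\ 0 <= C, (0 < N)%N & forall n, (N <= n)%N -> `|u n| <= C * n%:R ^+ d].
Proof.
move=> [C [N uC]]; exists `|C|, N.+1; split=> // n Nn.
by apply: le_trans (uC n (ltnW Nn)) _; rewrite ler_wpM2r ?exprn_ge0 ?ler0n ?ler_norm.
Qed.

Lemma poly_bounded_eq d u v N :
  (forall n, (N <= n)%N -> u n = v n) -> poly_bounded d u -> poly_bounded d v.
Proof.
move=> uv [C [N' uC]]; exists C, (maxn N N') => n; rewrite geq_max => /andP[Nn N'n].
by rewrite -uv // uC.
Qed.

Lemma poly_boundedW d e u : (d <= e)%N -> poly_bounded d u -> poly_bounded e u.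
Proof.
move=> de /poly_bounded_pos[C [N [C0 N0 uC]]]; exists C, N => n Nn.
apply: le_trans (uC n Nn) _; rewrite ler_wpM2l //.
by rewrite ler_weXn2l // ler1n (leq_trans N0).
Qed.

Lemma poly_boundedD d u v :
  poly_bounded d u -> poly_bounded d v -> poly_bounded d (fun n => u n + v n).
Proof.
move=> [C [N uC]] [C' [N' uC']]; exists (C + C'), (maxn N N') => n.
rewrite geq_max => /andP[Nn N'n]; rewrite mulrDl.
by apply: le_trans (ler_normD _ _) _; rewrite lerD ?uC ?uC'.
Qed.

Lemma poly_boundedM d e u v :
  poly_bounded d u -> poly_bounded e v -> poly_bounded (d + e) (fun n => u n * v n).
Proof.
move=> [C [N uC]] [C' [N' uC']]; exists (C * C'), (maxn N N') => n.
rewrite geq_max => /andP[Nn N'n]; rewrite normrM exprD mulrACA.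
by rewrite ler_pM ?uC ?uC'.
Qed.

Lemma poly_bounded_cst (a : R) : poly_bounded 0 (fun=> a).
Proof. by exists `|a|, 0%N => n _; rewrite expr0 mulr1. Qed.

Lemma poly_bounded_exp d : poly_bounded d (fun n => n%:R ^+ d).
Proof. by exists 1, 0%N => n _; rewrite mul1r ger0_norm ?exprn_ge0 ?ler0n. Qed.

Lemma poly_boundedZ d (a : R) u : poly_bounded d u -> poly_bounded d (fun n => a * u n).
Proof. by move=> ub; apply: (poly_boundedM (poly_bounded_cst a) ub). Qed.

Lemma poly_boundedB d u v :
  poly_bounded d u -> poly_bounded d v -> poly_bounded d (fun n => u n - v n).
Proof.
move=> ub vb; apply: (poly_bounded_eq (N := 0)) (poly_boundedD ub (poly_boundedZ (-1) vb)).
by move=> n _; rewrite mulN1r.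
Qed.

Lemma poly_bounded_sum d (I : finType) (P : pred I) (u : I -> nat -> R) :
  (forall i, P i -> poly_bounded d (u i)) ->
  poly_bounded d (fun n => \sum_(i | P i) u i n).
Proof.
move=> ub; elim: (index_enum I) => [|i r IH].
  apply: (poly_bounded_eq (N := 0)) (poly_boundedW (leq0n d) (poly_bounded_cst 0)).
  by move=> n _; rewrite big_nil.
have [Pi|Pi] := boolP (P i).
  apply: (poly_bounded_eq (N := 0)) (poly_boundedD (ub i Pi) IH).
  by move=> n _; rewrite big_cons Pi.
by apply: (poly_bounded_eq (N := 0)) IH => n _; rewrite big_cons (negbTE Pi).
Qed.

(** For [n < k], where the subtraction of naturals truncates, both sides vanish. *)
Lemma natr_ffactS n k : (n ^_ k.+1)%:R = (n ^_ k)%:R * (n%:R - k%:R) :> R.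
Proof.
rewrite ffactnSr natrM; have [kn|nk] := leqP k n; first by rewrite natrB.
by rewrite ffact_small // !mul0r.
Qed.

Lemma ffact_lead k :
  poly_bounded k (fun n => (n ^_ k.+1)%:R - n%:R ^+ k.+1).
Proof.
elim: k => [|k IH].
  apply: (poly_bounded_eq (N := 0)) (poly_bounded_cst 0) => n _.
  by rewrite ffactn1 expr1 subrr.
have ub : poly_bounded k.+1 (fun n => (n ^_ k.+1)%:R).
  apply: (poly_bounded_eq (N := 0)) (poly_boundedD (poly_boundedW (leqnSn k) IH)
    (poly_bounded_exp k.+1)) => n _ /=; by rewrite subrK.
have IH1 := poly_boundedM IH (poly_bounded_exp 1); rewrite addn1 in IH1.
apply: (poly_bounded_eq (N := 0)) (poly_boundedB IH1 (poly_boundedZ k.+1%:R ub)).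
by move=> n _; rewrite [in RHS]natr_ffactS [in RHS]exprSr expr1; ring.
Qed.

(** The second coefficient is minus [0 + 1 + ... + (k + 1) = 'C(k + 2, 2)]; the induction step adds
    [k + 2], in accordance with Pascal's rule. *)
Lemma ffact_sublead k :
  poly_bounded k (fun n => (n ^_ k.+2)%:R -
    (n%:R ^+ k.+2 - 'C(k.+2, 2)%:R * n%:R ^+ k.+1)).
Proof.
elim: k => [|k IH].
  apply: (poly_bounded_eq (N := 0)) (poly_bounded_cst 0) => n _.
  by rewrite natr_ffactS ffactn1 binn; ring.
have IH1 := poly_boundedM IH (poly_bounded_exp 1); rewrite addn1 in IH1.
apply: (poly_bounded_eq (N := 0)) (poly_boundedB IH1 (poly_boundedZ k.+2%:R (ffact_lead k.+1))).
move=> n _; rewrite [in RHS]natr_ffactS ['C(k.+3, 2)]binS bin1 natrD expr1.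
by rewrite !exprS; ring.
Qed.

(** The leading terms cancel, and the next coefficients give [- 'C(2m, 2) + 2 'C(m, 2) = - m^2]. *)
Lemma ffact_double_sub_sqr m : (1 < m)%N ->
  poly_bounded (2 * m - 2)
    (fun n => (n ^_ (2 * m))%:R - (n ^_ m)%:R ^+ 2 + m%:R ^+ 2 * n%:R ^+ (2 * m - 1)).
Proof.
case: m => [|[|m]] // _.
(* [b] collects the two top terms of the falling factorial [a], so that [a^2 - b^2 = (a - b)(a + b)]
   loses two degrees against [a^2]. *)
pose b n : R := n%:R ^+ m.+2 - 'C(m.+2, 2)%:R * n%:R ^+ m.+1.
have bb : poly_bounded m.+2 b.
  apply: poly_boundedB; first exact: poly_bounded_exp.
  by apply: poly_boundedZ; apply: poly_boundedW (poly_bounded_exp m.+1).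
have ab : poly_bounded m (fun n => (n ^_ m.+2)%:R - b n) := ffact_sublead m.
have ab2 : poly_bounded m.+2 (fun n => (n ^_ m.+2)%:R + b n).
  apply: (poly_bounded_eq (N := 0)) (poly_boundedD
    (poly_boundedW (leq_trans (leqnSn _) (leqnSn _)) ab) (poly_boundedZ 2 bb)) => n _.
  by ring.
have H1 := poly_boundedM ab ab2.
have E : (2 * m.+2)%N = (m + m.+2).+2 by lia.
have -> : (2 * m.+2 - 2)%N = (m + m.+2)%N by lia.
have -> : (2 * m.+2 - 1)%N = (m + m.+2).+1 by lia.
rewrite E; have H2 := ffact_sublead (m + m.+2).
(* [H3] absorbs the square of the second term of [b]. *)
have H3 := poly_boundedZ ('C(m.+2, 2)%:R ^+ 2) (poly_bounded_exp (m + m.+2)).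
apply: (poly_bounded_eq (N := 0)) (poly_boundedB (poly_boundedB H2 H1) H3) => n _.
have -> : 'C((m + m.+2).+2, 2) = (2 * 'C(m.+2, 2) + m.+2 ^ 2)%N.
  have := bin_ffact (m + m.+2).+2 2; have := bin_ffact m.+2 2.
  by rewrite !ffactnS !ffactn0 !muln1 /= !factS fact0; nia.
rewrite /b natrD natrM natrX !exprS exprD !exprS; ring.
Qed.

End PolyBounded.

(** * Moments, variance and standard deviation of the number of occurrences *)

Lemma unif_varE (R : realType) (T : finType) (X : T -> R) : (0 < #|T|)%N ->
  unif_var X = unif_mean (fun t => X t ^+ 2) - unif_mean X ^+ 2.
Proof.
move=> T0; have T0' : #|T|%:R != 0 :> R by rewrite pnatr_eq0 -lt0n.
rewrite /unif_var {1 3}/unif_mean; set mu := unif_mean X.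
have -> : \sum_t (X t - mu) ^+ 2 = \sum_t X t ^+ 2 - 2 * mu * \sum_t X t + #|T|%:R * mu ^+ 2.
  have sq t : (X t - mu) ^+ 2 = X t ^+ 2 - 2 * mu * X t + mu ^+ 2 by ring.
  under eq_bigr => t _ do rewrite sq.
  by rewrite big_split /= sumrB -mulr_sumr sumr_const -[mu ^+ 2 *+ _]mulr_natl.
have -> : \sum_t X t = mu * #|T|%:R by rewrite divfK.
by field.
Qed.

(** For [2s <= n] every factor of the falling factorial is at least [n / 2]. *)
Lemma leq_expn_ffact n s : (2 * s <= n)%N -> (n ^ s <= 2 ^ s * n ^_ s)%N.
Proof.
elim: s => [|s IH] sn //; rewrite ffactnSr !expnSr mulnACA leq_mul ?IH //; lia.
Qed.

Lemma ffactnD n a b : (n ^_ (a + b) = n ^_ a * (n - a) ^_ b)%N.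
Proof.
elim: b => [|b IH]; first by rewrite addn0 muln1.
by rewrite addnS !ffactnSr IH subnDA mulnA.
Qed.

Definition moment_term (R : realType) m (pi : 'S_m) (M : {set 'I_m * 'I_m}) n : R :=
  (coincidence_number n M * coincidence_number n (perm_pairs pi M) *
    (n - (2 * m - #|M|))`!)%N%:R / n`!%:R.

(** This transfers an error [O(n ^ (2m - 2))] of the variance to an error [O(n ^ (m - 1))] of the
    standard deviation. For [0 <= b <= a] it is the subadditivity of the square root. *)
Lemma ler_dist_sqrt (R : rcfType) (a b : R) : `|Num.sqrt a - Num.sqrt b| <= Num.sqrt `|a - b|.
Proof.
wlog ab : a b / b <= a => [th|].
  by case/orP: (le_total b a) => /th //; rewrite distrC [`|a - b|]distrC.
rewrite !ger0_norm ?subr_ge0 ?ler_wsqrtr // lerBlDr.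
(* For [b < 0] the value [Num.sqrt b] is 0 by convention. *)
have [b0|b0] := leP 0 b; last first.
  by rewrite [Num.sqrt b]ler0_sqrtr ?addr0 ?ler_wsqrtr ?(ltW b0) // lerDl oppr_ge0 ltW.
have dE : Num.sqrt (a - b) ^+ 2 = a - b by rewrite sqr_sqrtr // subr_ge0.
have bE : Num.sqrt b ^+ 2 = b by rewrite sqr_sqrtr.
rewrite -[leRHS]ger0_norm ?addr_ge0 ?sqrtr_ge0 // -sqrtr_sqr ler_wsqrtr // sqrrD dE bE.
by rewrite -addrAC subrK lerDl mulrn_wge0 // mulr_ge0 ?sqrtr_ge0.
Qed.

Section Variance.
Variables (R : realType) (m : nat) (pi : 'S_m).
Hypothesis m1 : (1 < m)%N.

Local Notation term := (moment_term R pi).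

Lemma ratio_fact n s : (s <= n)%N -> (n - s)`!%:R / n`!%:R = (n ^_ s)%:R^-1 :> R.
Proof.
move=> sn; have := ffact_fact sn => <-; rewrite natrM.
have h1 : (n ^_ s)%:R != 0 :> R by rewrite pnatr_eq0 -lt0n ffact_gt0.
have h2 : (n - s)`!%:R != 0 :> R by rewrite pnatr_eq0 -lt0n fact_gt0.
by field; rewrite h1 h2.
Qed.

Lemma unif_mean_Xocc n : (m <= n)%N ->
  unif_mean (Xocc R pi (n := n)) = (n ^_ m)%:R / m`!%:R ^+ 2.
Proof.
move=> mn; rewrite /unif_mean /Xocc -natr_sum sum_nocc card_Sn natrM -mulrA ratio_fact //.
have h1 : (n ^_ m)%:R != 0 :> R by rewrite pnatr_eq0 -lt0n ffact_gt0.
have h2 : m`!%:R != 0 :> R by rewrite pnatr_eq0 -lt0n fact_gt0.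
have := bin_ffact n m => /(congr1 (fun k => k%:R : R)); rewrite natrM natrX => e.
rewrite -e in h1 *; move: h1; rewrite mulf_eq0 negb_or => /andP[h1 _].
by field; rewrite h1 h2.
Qed.

Lemma unif_mean_Xocc_sqr n :
  unif_mean (fun tau => Xocc R pi (n := n) tau ^+ 2) = \sum_M term M n.
Proof.
rewrite /unif_mean card_Sn /Xocc -mulr_suml -natr_sum -sum_nocc_sqr natr_sum.
by congr (_ / _); apply: eq_bigr => tau _; rewrite natrX.
Qed.

(** Each of the two coincidence numbers is [n ^_ (2 * m)] over the square of m!; one falling
    factorial cancels against the ratio of factorials. *)
Lemma moment_term0 n : (2 * m <= n)%N -> term set0 n = (n ^_ (2 * m))%:R / m`!%:R ^+ 4.
Proof.
move=> mn; rewrite /moment_term /perm_pairs imset0 cards0 subn0 natrM -mulrA ratio_fact //.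
rewrite coincidence_number0.
have h1 : (n ^_ (2 * m))%:R != 0 :> R by rewrite pnatr_eq0 -lt0n ffact_gt0.
have h2 : m`!%:R != 0 :> R by rewrite pnatr_eq0 -lt0n fact_gt0.
have : ('C(n, m) * 'C(n - m, m))%N%:R * m`!%:R ^+ 2 = (n ^_ (2 * m))%:R :> R.
  by rewrite -natrX -natrM mulnACA !bin_ffact -ffactnD addnn mul2n.
move=> e; rewrite natrM -e; rewrite -e mulf_eq0 negb_or in h1; case/andP: h1.
by move: (_ * _)%N%:R => N N0 _; field; rewrite N0 h2.
Qed.

Lemma moment_term1 i j n : (2 * m <= n)%N -> term [set (i, j)] n =
  ((bracket m i.+1 j.+1)%:R * (bracket m (pi i).+1 (pi j).+1)%:R) *
  ((n ^_ (2 * m - 1))%:R / (2 * m - 1)`!%:R ^+ 2).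
Proof.
move=> mn; rewrite /moment_term /perm_pairs imset_set1 cards1 natrM -mulrA.
rewrite ratio_fact ?(leq_trans (leq_subr _ _)) //.
rewrite !coincidence_number1.
have h1 : (n ^_ (2 * m - 1))%:R != 0 :> R.
  by rewrite pnatr_eq0 -lt0n ffact_gt0 (leq_trans (leq_subr _ _)).
have h2 : (2 * m - 1)`!%:R != 0 :> R by rewrite pnatr_eq0 -lt0n fact_gt0.
have := bin_ffact n (2 * m - 1) => /(congr1 (fun k => k%:R : R)); rewrite natrM => e.
rewrite !natrM -e in h1 *; field.
by move: h1; rewrite mulf_eq0 negb_or => /andP[-> ->].
Qed.

(** With [s = 2m - #|M|], the coincidence numbers contribute at most [n ^ (2s)], while for large [n]
    the ratio of factorials is at most [2 ^ s / n ^ s]. *)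
Lemma moment_term_bounded (M : {set 'I_m * 'I_m}) :
  (1 < #|M|)%N -> poly_bounded (2 * m - 2) (term M).
Proof.
move=> M1; set s := (2 * m - #|M|)%N.
apply: (@poly_boundedW _ s); first by rewrite /s; lia.
exists (2 ^ s)%:R, (2 * s)%N => n sn.
have cardM : #|perm_pairs pi M| = #|M|.
  by rewrite card_imset // => -[a b] [c d] [/perm_inj -> /perm_inj ->].
rewrite /moment_term ger0_norm ?divr_ge0 ?ler0n // ler_pdivrMr ?ltr0n ?fact_gt0 //.
rewrite -natrX -!natrM ler_nat -/s.
have sn' : (s <= n)%N by lia.
rewrite -(ffact_fact sn') mulnA leq_mul2r; apply/orP; right.
rewrite mulnAC [leqRHS]mulnC.
have := coincidence_number_le n M; have := coincidence_number_le n (perm_pairs pi M).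
rewrite cardM -/s => H1 H2; apply: leq_mul => //.
exact: leq_trans (leq_expn_ffact sn).
Qed.

(** Three errors add up: [H1] from the sets with at least two pairs, [H2] from the empty set against
    the squared mean, [H4] from replacing a falling factorial by a power in the singleton terms. *)
Lemma unif_var_Xocc_asymp :
  poly_bounded (2 * m - 2)
    (fun n => unif_var (Xocc R pi (n := n)) - c_coef R pi * n%:R ^+ (2 * m - 1)).
Proof.
have H1 := poly_bounded_sum (fun M : {set 'I_m * 'I_m} => @moment_term_bounded M).
have H2 := poly_boundedZ (m`!%:R ^- 4) (ffact_double_sub_sqr R m1).
have H3 := ffact_lead R (2 * m - 2).
have E1 : ((2 * m - 2).+1 = 2 * m - 1)%N by lia.
rewrite E1 in H3.
have H4 := poly_boundedZ (trace_term R pi / (2 * m - 1)`!%:R ^+ 2) H3.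
apply: (poly_bounded_eq (N := (2 * m)%N)) (poly_boundedD H1 (poly_boundedD H2 H4)) => n mn.
rewrite unif_varE ?card_Sn ?fact_gt0 // unif_mean_Xocc_sqr unif_mean_Xocc; last by lia.
rewrite [\sum_(M : {set 'I_m * 'I_m}) _](bigD1 set0) //= moment_term0 //.
rewrite [\sum_(M : {set 'I_m * 'I_m} | M != set0) _](bigID
  (fun M : {set 'I_m * 'I_m} => #|M| == 1%N)) /=.
(* The singletons run over all pairs [(i, j)], so their bracket products sum to the trace. *)
have -> : \sum_(M : {set 'I_m * 'I_m} | (M != set0) && (#|M| == 1%N)) term M n =
    trace_term R pi * ((n ^_ (2 * m - 1))%:R / (2 * m - 1)`!%:R ^+ 2).
  rewrite trace_termE pair_big big_distrl /=.
  rewrite (eq_bigl (mem [set [set x] | x : 'I_m * 'I_m])); last first.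
    move=> M; rewrite /= -cards_eq0; apply/andP/imsetP => [[_ /cards1P[x ->]]|[x _ ->]].
      by exists x.
    by rewrite cards1.
  rewrite big_imset /=; last by move=> x y _ _; apply: set1_inj.
  by apply: eq_big => // -[i j] _; apply: moment_term1.
have -> : \sum_(M : {set 'I_m * 'I_m} | (M != set0) && (#|M| != 1%N)) term M n =
    \sum_(M : {set 'I_m * 'I_m} | (1 < #|M|)%N) term M n.
  by apply: eq_bigl => M; rewrite -cards_eq0; case: #|M| => [|[]].
have f1 : m`!%:R != 0 :> R by rewrite pnatr_eq0 -lt0n fact_gt0.
have f2 : (2 * m - 1)`!%:R != 0 :> R by rewrite pnatr_eq0 -lt0n fact_gt0.
(* Both sides are the square of 1 / (m! (m - 1)!); this turns the coefficient coming from [H2] into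
   the binomial term of [c_coef]. *)
have E : m%:R ^+ 2 / m`!%:R ^+ 4 = ('C(2 * m - 1, m - 1))%:R ^+ 2 / (2 * m - 1)`!%:R ^+ 2 :> R.
  have le : (m - 1 <= 2 * m - 1)%N by lia.
  have := bin_fact le; rewrite (_ : 2 * m - 1 - (m - 1) = m)%N; last by lia.
  have := factS (m - 1); rewrite (_ : (m - 1).+1 = m); last by lia.
  move=> e1 /(congr1 (fun k => k%:R : R)); rewrite !natrM => e2.
  rewrite -e2 in f2 *; move: e1 f1 => /(congr1 (fun k => k%:R : R)); rewrite natrM => e1 f1.
  rewrite e1 in f1 f2 *; field.
  by move: f2 f1; rewrite !mulf_eq0 !negb_or => /and3P[-> -> _] /andP[-> _].
have E2 : ('C(2 * m - 1, m - 1))%:R ^+ 2 = m%:R ^+ 2 / m`!%:R ^+ 4 * (2 * m - 1)`!%:R ^+ 2 :> R.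
  by rewrite E divfK // expf_neq0.
rewrite /c_coef E2.
move: (\sum_(M : {set 'I_m * 'I_m} | _) _) (trace_term R pi) => S T.
by field; rewrite f1 f2.
Qed.

Lemma unif_sd_Xocc_asymp : poly_bounded (m - 1)
  (fun n => unif_sd (Xocc R pi (n := n)) - Num.sqrt (c_coef R pi) * (n%:R `^ (m%:R - 2^-1))).
Proof.
have [C [N [C0 N0 VC]]] := poly_bounded_pos unif_var_Xocc_asymp.
exists (Num.sqrt C), N => n Nn.
have n0 : 0 <= n%:R :> R by [].
have -> : n%:R `^ (m%:R - 2^-1) = Num.sqrt (n%:R ^+ (2 * m - 1)) :> R.
  rewrite -powR12_sqrt ?exprn_ge0 // -powR_mulrn // -powRrM; congr (_ `^ _).
  by rewrite natrB ?natrM; [field | lia].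
rewrite -sqrtrM ?(ltW (c_coef_gt0 R pi m1)) // /unif_sd.
have -> : n%:R ^+ (m - 1) = Num.sqrt (n%:R ^+ (2 * m - 2)) :> R.
  rewrite (_ : 2 * m - 2 = (m - 1) * 2)%N; last by lia.
  by rewrite exprM sqrtr_sqr ger0_norm // exprn_ge0.
rewrite -sqrtrM //; apply: le_trans (ler_dist_sqrt _ _) _; last first.
  by rewrite ler_sqrt ?VC // mulr_ge0 // exprn_ge0.
Qed.

End Variance.

(** * Translation into Landau notation *)

Local Open Scope classical_set_scope.
Local Open Scope ring_scope.
Lemma eqaddO_poly_bounded (R : realType) d (u v : nat -> R) :
  poly_bounded d (fun n => u n - v n) ->
  u = v +O_ \oo (fun n : nat => n%:R ^+ d : R).
Proof.
(* [eqaddOP] asks for the bound with every sufficiently large constant; all [k >= C] serve. *)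
move=> [C [N uC]]; apply/eqaddOP; apply: filterS (nbhs_pinfty_ge (num_real C)) => k Ck.
exists N => // n Nn; rewrite [`|n%:R ^+ d|]ger0_norm ?exprn_ge0 //.
by apply: le_trans (uC n Nn) _; rewrite ler_wpM2r ?exprn_ge0.
Qed.

Theorem theorem4p2 (R : realType) (m : nat) (hm : (1 < m)%N) (pi : 'S_m) :
  [/\ (fun n : nat => unif_var (Xocc R pi (n := n)))
        = (fun n : nat => c_coef R pi * n%:R ^+ (2 * m - 1))
          +O_ \oo (fun n : nat => n%:R ^+ (2 * m - 2) : R),
      0 < c_coef R pi,
      trace_term R pi =
        \sum_(i < m) \sum_(j < m)
          (bracket m i.+1 j.+1)%:R * (bracket m (pi i).+1 (pi j).+1)%:R
    & (fun n : nat => unif_sd (Xocc R pi (n := n)))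
        = (fun n : nat => Num.sqrt (c_coef R pi) * (n%:R `^ (m%:R - 2^-1)))
          +O_ \oo (fun n : nat => n%:R ^+ (m - 1) : R)].
Proof.
split; first exact/eqaddO_poly_bounded/unif_var_Xocc_asymp.
- exact: c_coef_gt0.
- exact: trace_termE.
- exact/eqaddO_poly_bounded/unif_sd_Xocc_asymp.
Qed.
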